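(* Let $R>0$ and let $f$ be a non-constant analytic function in an open connected subset of $\mathbb{C}$ containing $\overline{D}(0;R)=\{z\in\mathbb{C}:|z|\le R\}$. Then the image of $f$ contains an open disk centered at $f(0)$.
   Context: A function $f:\Omega\to\mathbb{C}$ on an open set $\Omega\subset\mathbb{C}$ is analytic if around each $z_0\in\Omega$ it is given on some open disk centered at $z_0$ and contained in $\Omega$ by a convergent power series in $z-z_0$. Open disks have strictly positive radius. *)

(* Defs.v *)
From HB Require Import structures.
From mathcomp Require Import all_boot all_order all_algebra.
From mathcomp Require Import complex.
From mathcomp Require Import all_classical all_reals all_analysis.
Import Order.TTheory GRing.Theory Num.Theory numFieldNormedType.Exports.

Set Implicit Arguments.
Unset Strict Implicit.
Unset Printing Implicit Defensive.

Local Open Scope classical_set_scope.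
Local Open Scope ring_scope.
Local Open Scope complex_scope.

(* [R[i]] itself carries no topology in the library; presented as the carrier
   of a [numFieldType], it gets the one defined by the modulus. *)
Definition C (R : realType) : numFieldType := R[i].

(* The modulus takes its values in [C R] itself (as elements with zero
   imaginary part), hence the injection of the real radius. *)
Definition disk (R : realType) (z0 : C R) (r : R) : set (C R) :=
  ball z0 (r%:C : C R).

Definition closed_disk (R : realType) (z0 : C R) (r : R) : set (C R) :=
  [set z | `|z - z0| <= (r%:C : C R)].

(* The values of [f] outside [Omega] are irrelevant. *)
Definition analytic_on (R : realType) (Omega : set (C R)) (f : C R -> C R) :
    Prop :=
  forall z0, Omega z0 ->
    exists (r : R) (a : nat -> C R),
      [/\ 0 < r, disk z0 r `<=` Omega &
        forall z, disk z0 r z ->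
          [series a k * (z - z0) ^+ k]_k @ \oo --> f z].

Definition constant_on (R : realType) (Omega : set (C R)) (f : C R -> C R) :
    Prop :=
  exists c, forall z, Omega z -> f z = c.

(* Main.v *)
Require Import Defs.
From HB Require Import structures.
From mathcomp Require Import all_boot all_order all_algebra.
From mathcomp Require Import complex ring.
From mathcomp Require Import all_classical all_reals all_analysis.
Import Order.TTheory GRing.Theory Num.Theory numFieldNormedType.Exports.

Local Open Scope classical_set_scope.
Local Open Scope ring_scope.

(** Put the minimum modulus argument on a small circle around the centre. Near
    any point [z0], a power series is either constant or behaves like
    [f z0 + c * (z - z0) ^+ m] with [c != 0] and [0 < m], up to an error of
    order [m + 1] ([power_series_leading_term]); the error is controlled by
    comparison with a geometric series ([power_series_remainder]). Three facts
    are read off from this expansion.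

    - The value [f z0] is not taken again near [z0]
      ([leading_term_isolated]). Hence the set of points around which [f] is
      locally equal to a given constant is open and closed in the domain, and
      a non-constant [f] on a connected domain has a leading term at every
      point ([identity_principle]).
    - If [w != f z0], the distance from [f z] to [w] does not have a local
      minimum at [z0]: moving in a direction [u] with
      [c * u ^+ m = - (f z0 - w)] decreases it ([leading_term_descent]). This
      is d'Alembert's argument for the fundamental theorem of algebra.
    - [f] is continuous.

    Choose a circle of radius [s] around [0], with its closed disk inside the
    domain, on which [f] avoids [f 0], and let [d > 0] be the minimum of
    [`|f z - f 0|] on it. If [`|f 0 - w| < d / 2], then on the circle [f] stays
    further than [d / 2] from [w]; so the minimum of [`|f z - w|] over the
    closed disk is attained at an interior point, and by the descent property
    that minimum is a point where [f z = w]. Thus the disk of radius [d / 2]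
    around [f 0] lies in the image. *)

(** * Power series near their centre *)

Lemma geometric_sum_le {K : numFieldType} (q : K) (n N : nat) :
  0 <= q -> q <= 2^-1 -> \sum_(n <= k < N) q ^+ k <= 2 * q ^+ n.
Proof.
move=> q0 q2.
have [/(@big_geq K 0 +%R)->|/ltnW] := leqP N n.
  by rewrite mulr_ge0 ?exprn_ge0.
move=> /subnKC <-; set d := (N - n)%N.
suff : \sum_(n <= k < n + d) q ^+ k <= 2 * q ^+ n - 2 * q ^+ (n + d).
  by move=> /le_trans; apply; rewrite gerBl mulr_ge0 ?exprn_ge0.
elim: d => [|d IH]; first by rewrite addn0 big_geq ?subrr.
rewrite addnS big_nat_recr ?leq_addr//=.
apply: le_trans (lerD IH (lexx _)) _.
rewrite exprS -subr_ge0 (_ : _ - _ = q ^+ (n + d) * (1 - 2 * q)); last by ring.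
rewrite mulr_ge0 ?exprn_ge0// subr_ge0.
by rewrite mulrC -ler_pdivlMr ?ltr0n// mul1r.
Qed.

Lemma cvg_norm_le {K : numFieldType} (V : normedModType K) (u : nat -> V)
    (l y : V) (b : K) :
  u @ \oo --> l -> (\forall N \near \oo, `|u N - y| <= b) -> `|l - y| <= b.
Proof.
move=> ul ub; apply/ler_addgt0Pl => e e0.
have ule := cvgr_dist_lt _ _ ul _ e0.
near \oo => N.
rewrite (_ : l - y = (l - u N) + (u N - y)); last by rewrite addrA subrK.
apply: le_trans (ler_normD _ _) _; apply: lerD; last by near: N.
by apply: ltW; near: N; exact: ule.
Unshelve. all: by end_near. Qed.

Lemma near_dist_lt {K : numFieldType} (z0 e : K) :
  0 < e -> \forall z \near z0, `|z - z0| < e.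
Proof.
by move=> e0; apply/nbhs_normP; exists e => // z /=; rewrite distrC.
Qed.

Definition has_sum_on {K : numFieldType} (a : nat -> K) (z0 r : K)
    (f : K -> K) : Prop :=
  forall z, ball z0 r z -> [series a k * (z - z0) ^+ k]_k @ \oo --> f z.

(** The terms are bounded at a point at distance [p < r] from the centre, so
    [a k = O(p ^- k)], and within distance [p / 2] the tail of the series is
    dominated by a geometric series of ratio at most [1 / 2]. *)
Lemma power_series_remainder {K : numFieldType} (a : nat -> K) (f : K -> K)
    (z0 r : K) (n : nat) :
  0 < r ->
  has_sum_on a z0 r f ->
  exists2 M, 0 <= M & \forall z \near z0,
    `|f z - \sum_(0 <= k < n) a k * (z - z0) ^+ k| <= M * `|z - z0| ^+ n.
Proof.
move=> r0 fE; have [p p0 pr] : exists2 p, 0 < p & p < r.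
  by exists (r / 2); rewrite ?divr_gt0// ltr_pdivrMr// ltr_pMr// ltr1n.
have [B B0 aB] : exists2 B, 0 < B & forall k, `|a k| * p ^+ k <= B.
  have zp : ball z0 r (z0 + p).
    by rewrite -ball_normE /= opprD addNKr normrN gtr0_norm.
  have /cvg_series_cvg_0 : cvgn [series a k * (z0 + p - z0) ^+ k]_k.
    by apply/cvg_ex; exists (f (z0 + p)); exact: fE.
  move=> u0; have : cvgn (fun k => a k * (z0 + p - z0) ^+ k).
    by apply/cvg_ex; exists 0.
  move=> /cvg_seq_bounded /pinfty_ex_gt0[B B0 uB]; exists B => // k.
  have /= := uB k I; rewrite normrM normrX.
  by rewrite [z0 + p]addrC addrK (gtr0_norm p0).
exists (2 * B / p ^+ n).
  by rewrite !mulr_ge0 ?invr_ge0 ?exprn_ge0 // ltW.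
apply/nbhs_normP; exists (p / 2); first by rewrite /= divr_gt0.
move=> z /=; rewrite distrC => /ltW zp.
have q0 : 0 <= `|z - z0| / p by rewrite divr_ge0 // ltW.
have q2 : `|z - z0| / p <= 2^-1 by rewrite ler_pdivrMr // mulrC.
apply: (@cvg_norm_le K K ([series a k * (z - z0) ^+ k]_k)).
  apply: fE; rewrite -ball_normE /= distrC; apply: le_lt_trans zp _.
  by apply: lt_trans pr; rewrite ltr_pdivrMr// ltr_pMr// ltr1n.
near=> N.
have nN : (n <= N)%N by near: N; exact: nbhs_infty_ge.
rewrite /series/= (big_cat_nat (n := n)) //= addrC addrK.
apply: le_trans (ler_norm_sum _ _ _) _.
apply: (@le_trans _ _ (B * \sum_(n <= k < N) (`|z - z0| / p) ^+ k)).
  rewrite mulr_sumr; apply: ler_sum => k _.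
  rewrite normrM normrX expr_div_n mulrCA [leRHS]mulrC.
  by rewrite ler_wpM2r ?exprn_ge0// ler_pdivlMr ?exprn_gt0.
rewrite (_ : 2 * B / p ^+ n * `|z - z0| ^+ n =
   B * (2 * (`|z - z0| / p) ^+ n)); last first.
  by rewrite expr_div_n [`|z - z0| ^+ n * _]mulrC -!mulrA mulrCA.
by rewrite ler_pM2l// geometric_sum_le.
Unshelve. all: by end_near. Qed.

Lemma power_series_center {K : numFieldType} (a : nat -> K) (f : K -> K)
    (z0 r : K) :
  0 < r -> has_sum_on a z0 r f ->
  a 0 = f z0.
Proof.
move=> r0 fE.
have [M M0 /nbhs_singleton] := power_series_remainder _ _ _ _ 1 r0 fE.
rewrite big_nat1 subrr normr0 expr0 expr1 mulr1 mulr0 normr_le0 subr_eq0.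
by move=> /eqP.
Qed.

Lemma power_series_continuous {K : numFieldType} (a : nat -> K) (f : K -> K)
    (z0 r : K) :
  0 < r -> has_sum_on a z0 r f ->
  {for z0, continuous f}.
Proof.
move=> r0 fE.
have [M M0] := power_series_remainder _ _ _ _ 1 r0 fE.
move=> rem; apply/(@cvgrPdist_lt K K _ _ (nbhs_filter z0)) => e e0.
have Me : 0 < e / (M + 1) by rewrite divr_gt0// ltr_wpDl.
have near_z := near_dist_lt z0 _ Me.
near=> z.
have : `|f z - f z0| <= M * `|z - z0|.
  rewrite -(power_series_center _ _ _ _ r0 fE).
  suff: `|f z - \sum_(0 <= k < 1) a k * (z - z0) ^+ k| <= M * `|z - z0| ^+ 1.
    by rewrite big_nat1 expr0 mulr1 expr1.
  by near: z.
rewrite distrC => /le_lt_trans; apply.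
have : `|z - z0| < e / (M + 1) by near: z.
rewrite ltr_pdivlMr ?ltr_wpDl// mulrDr mulr1 mulrC; apply: le_lt_trans.
by rewrite lerDl.
Unshelve. all: by end_near. Qed.

(** * Leading terms *)

Definition leading_term {K : numFieldType} (f : K -> K) (z0 : K) (m : nat)
    (c : K) : Prop :=
  [/\ (0 < m)%N, c != 0 & exists2 M, 0 <= M & \forall z \near z0,
    `|f z - f z0 - c * (z - z0) ^+ m| <= M * `|z - z0| ^+ m.+1].

(** The leading term comes from the first non-zero coefficient of positive
    index; when there is none, the partial sums are constant. *)
Lemma power_series_leading_term {K : numFieldType} (a : nat -> K) (f : K -> K)
    (z0 r : K) :
  0 < r -> has_sum_on a z0 r f ->
  (\forall z \near z0, f z = f z0) \/ exists m c, leading_term f z0 m c.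
Proof.
move=> r0 fE.
have [ak0|] := pselect (forall k, a k.+1 = 0).
  left; apply/nbhs_ballP; exists r => // z zr.
  apply: (@cvg_unique _ (@norm_hausdorff K K) _ _ _ _ (fE _ zr)).
  apply: cvg_near_cst; near=> N.
  have N0 : (0 < N)%N by near: N; exact: nbhs_infty_gt.
  rewrite /series /= big_ltn // expr0 mulr1 big_nat big1 ?addr0.
    exact: power_series_center r0 fE.
  by move=> [|k] // _; rewrite ak0 mul0r.
move=> /existsNP[k0 /eqP ak0]; right.
have exm : exists k, a k.+1 != 0 by exists k0.
case: (ex_minnP exm) => k ak mink; exists k.+1, (a k.+1); split => //.
have [M M0 rem] := power_series_remainder _ _ _ _ k.+2 r0 fE.
exists M => //; apply: filterS rem => z.
rewrite big_nat_recr//= big_ltn // expr0 mulr1.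
rewrite (power_series_center _ _ _ _ r0 fE) big_nat big1 ?addr0 ?opprD ?addrA// => -[|j] //.
rewrite !ltnS => /andP[_ jk]; have [/mink|] := boolP (a j.+1 != 0).
  by rewrite leqNgt jk.
by rewrite negbK => /eqP ->; rewrite mul0r.
Unshelve. all: by end_near. Qed.

(** A return to [f z0] at [z] would force
    [`|c| <= M * `|z - z0|], which fails close to [z0]. *)
Lemma leading_term_isolated {K : numFieldType} (f : K -> K) (z0 : K) m c :
  leading_term f z0 m c -> \forall z \near z0, z != z0 -> f z != f z0.
Proof.
move=> [m0 c0 [M M0 rem]].
have cM : 0 < `|c| / (M + 1) by rewrite divr_gt0 ?normr_gt0// ltr_wpDl.
have near_z := near_dist_lt z0 _ cM.
near=> z; move=> zz0; apply/eqP => fz.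
have w0 : 0 < `|z - z0| by rewrite normr_gt0 subr_eq0.
have : `|f z - f z0 - c * (z - z0) ^+ m| <= M * `|z - z0| ^+ m.+1 by near: z.
rewrite fz subrr sub0r normrN normrM normrX exprSr.
rewrite [_ * `|z - z0|]mulrC mulrA ler_pM2r ?exprn_gt0//.
have : `|z - z0| < `|c| / (M + 1) by near: z.
rewrite ltr_pdivlMr ?ltr_wpDl// => wc cw.
suff : `|c| < `|c| by rewrite ltxx.
apply: le_lt_trans cw (le_lt_trans _ wc).
by rewrite mulrDr mulr1 mulrC lerDl.
Unshelve. all: by end_near. Qed.

(** Only the leading term matters along the ray [z0 + t * u]: the choice
    [c * u ^+ m = - b], with [b = f z0 - w], turns [f z - w] into
    [(1 - t ^+ m) * b] up to an error [t ^+ m.+1 * L], which loses to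
    [t ^+ m * `|b|] for small [t > 0]. The [m]-th root [u] exists because
    the complex numbers are algebraically closed. *)
Lemma leading_term_descent {R : realType} (f : C R -> C R) (z0 : C R) m c w U :
  leading_term f z0 m c -> f z0 != w -> nbhs z0 U ->
  exists2 z, U z & `|f z - w| < `|f z0 - w|.
Proof.
move=> [m0 c0 [M M0 rem]] fz0w Uz0.
set b := f z0 - w.
have b0 : 0 < `|b| by rewrite normr_gt0 subr_eq0.
have [u um] : exists u : C R, c * u ^+ m = - b.
  exists (m.-root ((- b / c) : R[i])).
  by rewrite (@rootCK R[i] _ m0) mulrCA divff// mulr1.
have [e /= e0 Ue] := (nbhs_normP _ _).1 (filterI rem Uz0).
pose L := M * `|u| ^+ m.+1.
have L0 : 0 <= L by rewrite mulr_ge0 ?exprn_ge0.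
(* The inverse of [D] serves as [t]: its three summands give [t < 1],
   [t * `|u| < e] and [t * L < `|b|]. A sum replaces a maximum because the
   order of [C R] is partial. *)
pose D := 2 + `|u| / e + L / `|b|.
have ue0 : 0 <= `|u| / e by rewrite divr_ge0 // ltW.
have Lb0 : 0 <= L / `|b| by rewrite divr_ge0.
have D2 : 2 <= D by rewrite /D -addrA lerDl addr_ge0.
have D1 : 1 < D by apply: lt_le_trans D2; rewrite ltr1n.
have D0 : 0 < D by apply: lt_trans D1.
pose t := D^-1.
have t0 : 0 < t by rewrite invr_gt0.
have t1 : t < 1 by rewrite invf_lt1.
have tu : t * `|u| < e.
  rewrite mulrC ltr_pdivrMr// -ltr_pdivrMl// mulrC /D addrAC ltrDr.
  by rewrite ltr_wpDr ?ltr0n.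
have tL : t * L < `|b|.
  by rewrite mulrC ltr_pdivrMr// -ltr_pdivrMl// mulrC /D ltrDr ltr_wpDr ?ltr0n.
have [] := Ue (z0 + t * u).
  by rewrite /= opprD addNKr normrN normrM (gtr0_norm t0).
rewrite [z0 + _]addrC addrK => remt Ut; exists (t * u + z0) => //.
set F := f _ in remt *.
rewrite (_ : F - w = (F - f z0 - c * (t * u) ^+ m) + (1 - t ^+ m) * b);
  last first.
  by rewrite exprMn mulrCA um /b; ring.
apply: le_lt_trans (ler_normD _ _) _.
apply: le_lt_trans (lerD remt (lexx _)) _.
have tm1 : 0 <= 1 - t ^+ m by rewrite subr_ge0 exprn_ile1 // ltW.
rewrite !normrM (gtr0_norm t0) (ger0_norm tm1) exprMn -subr_gt0.
rewrite (_ : _ - _ = t ^+ m * (`|b| - t * L)); last by rewrite exprS /L; ring.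
by rewrite mulr_gt0 ?exprn_gt0// subr_gt0.
Qed.

(** Openness of the set where [f] is locally [f z1] is immediate. It is closed
    in [Omega]: at a limit point [z] outside it, continuity gives
    [f z = f z1], so [f] takes the value [f z] at points other than [z]
    arbitrarily close to it, and the dichotomy leaves only local constancy. *)
Lemma identity_principle {K : numFieldType} (Omega : set K) (f : K -> K)
    (z1 : K) :
  open Omega -> connected Omega ->
  (forall z, Omega z -> {for z, continuous f}) ->
  (forall z, Omega z -> (\forall w \near z, f w = f z) \/
    (\forall w \near z, w != z -> f w != f z)) ->
  Omega z1 -> (\forall w \near z1, f w = f z1) ->
  forall z, Omega z -> f z = f z1.
Proof.
move=> oO cO fC dich O1 f1.
pose I := [set w | f w = f z1]°.
have IE : Omega `&` I = Omega.
  apply: cO.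
  - by exists z1; split.
  - by exists I => //; exact: open_interior.
  exists (closure (Omega `&` I)); first exact: closed_closure.
  apply/seteqP; split=> z [Oz zI]; split=> //; first by apply: subset_closure.
  apply: contrapT => nIz.
  have fz : f z = f z1.
    apply: contrapT => /eqP fz1.
    have /zI[w [[_ /nbhs_singleton fw] /= /negP]] :
        nbhs z [set w | f w != f z1].
      have d0 : 0 < `|f z1 - f z| by rewrite normr_gt0 subr_eq0 eq_sym.
      apply: (@filterS _ _ (nbhs_filter z) _ _ _
        (fC z Oz _ (near_dist_lt (f z) _ d0))) => w /=.
      by apply: contraTneq => ->; rewrite ltxx.
    by apply; rewrite fw.
  have [zc|iso] := dich z Oz; first by apply: nIz; rewrite /I -fz.
  have [w [[_ Iw] /= fw]] := zI _ iso.
  have [wz|/fw] := eqVneq w z; first by apply: nIz; rewrite -wz.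
  by rewrite fz (nbhs_singleton Iw) eqxx.
by move=> z; rewrite -{1}IE => -[_ /nbhs_singleton].
Qed.

(** * Extrema of the modulus on compact sets *)

(** The norm of [C R] takes its values in [C R], which is only partially
    ordered; the extreme value theorem needs its real counterpart. *)
Definition modulus {R : realType} (z : C R) : R := complex.Re (`|z| : R[i]).

Lemma modulusE {R : realType} (z : C R) : (modulus z)%:C%C = `|z|.
Proof. by apply: RRe_real; exact: normr_real. Qed.

Lemma le_modulus {R : realType} (z z' : C R) :
  (modulus z <= modulus z') = (`|z| <= `|z'|).
Proof. by rewrite -lecR !modulusE. Qed.

Lemma modulus_continuous {R : realType} :
  continuous (@modulus R).
Proof.
move=> z; apply/(@cvgrPdist_lt R R _ _ (nbhs_filter z)) => e e0.
have e0' : (0 : C R) < e%:C%C by rewrite ltcR.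
apply: filterS (near_dist_lt z _ e0') => y zy.
rewrite -ltcR; apply: le_lt_trans zy.
rewrite -raddfB.
apply: le_trans (normc_ge_Re _) _.
by rewrite distrC; apply: ler_dist_dist.
Qed.

Lemma real_complex_continuous {R : realType} :
  continuous (fun x : R => x%:C%C : C R).
Proof.
move=> x; apply/(@cvgrPdist_lt (C R) (C R) _ _ (nbhs_filter x)) => e e0.
have eE : (complex.Re (e : R[i]))%:C%C = e by apply: RRe_real; exact: gtr0_real.
have e0' : 0 < complex.Re (e : R[i]) by rewrite -ltcR eE.
apply: filterS (near_dist_lt x _ e0') => y xy.
rewrite -eE -rmorphB normc_def /= expr0n addr0 sqrtr_sqr ltcR distrC.
exact: xy.
Qed.

Lemma closed_closed_disk {R : realType} (s : R) :
  closed (closed_disk (0 : C R) s).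
Proof.
rewrite (_ : closed_disk _ _ =
  (@modulus R) @^-1` [set x | x <= s]); last first.
  by apply/seteqP; split=> z; rewrite /closed_disk /= subr0 -lecR modulusE.
apply: preimage_closed; last exact: closed_le.
by move=> z _; exact: modulus_continuous.
Qed.

(** The disk is a closed subset of the continuous image of the compact square
    [[-s, s] * [-s, s]] of [R * R]. *)
Lemma compact_closed_disk {R : realType} (s : R) :
  compact (closed_disk (0 : C R) s).
Proof.
pose g (p : R * R) : C R := p.1%:C%C + 'i%C * p.2%:C%C.
have gC : continuous g.
  move=> p; apply: cvgD; last apply: cvgM; first last.
  - by apply: continuous_comp; [exact: cvg_snd|exact: real_complex_continuous].
  - exact: cvg_cst.
  - by apply: continuous_comp; [exact: cvg_fst|exact: real_complex_continuous].
apply: (@subclosed_compact _ _ (g @` (`[-s, s] `*` `[-s, s]))).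
- exact: closed_closed_disk.
- apply: continuous_compact; first exact: continuous_subspaceT.
  by apply: compact_setX; exact: segment_compact.
- move=> z; rewrite /closed_disk /= subr0 => zs.
  exists (complex.Re (z : R[i]), complex.Im (z : R[i])); last first.
    by rewrite /g /= -complexE.
  rewrite /= !in_itv /= -!ler_norml; split; rewrite -lecR; apply: le_trans zs.
    exact: normc_ge_Re.
  have := normc_ge_Re ((z : R[i]) * 'i%C).
  by rewrite ReiNIm normrN normrM complexiE normCi mulr1.
Qed.

Lemma compact_min_modulus {R : realType} (A : set (C R)) (g : C R -> C R) :
  A !=set0 -> compact A -> (forall z, A z -> {for z, continuous g}) ->
  exists2 z, A z & forall z', A z' -> `|g z| <= `|g z'|.
Proof.
move=> A0 cA gA.
have [|z] := compact_EVT_min A0 cA (f := fun z => modulus (g z)).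
  apply: continuous_in_subspaceT => z; rewrite inE => Az.
  apply: (@continuous_comp _ _ _ g (@modulus R)).
    exact: gA.
  exact: modulus_continuous.
rewrite inE => Az zmin; exists z => // z' Az'.
by have := zmin z'; rewrite inE => /(_ Az'); rewrite le_modulus.
Qed.

(** * The image contains a disk *)

Theorem theorem7p3 (R : realType) (Omega : set (C R)) (f : C R -> C R)
    (rho : R) (rho_gt0 : 0 < rho)
    (Omega_open : open Omega) (Omega_connected : connected Omega)
    (disk_sub : closed_disk (0 : C R) rho `<=` Omega)
    (f_analytic : analytic_on Omega f)
    (f_nonconstant : ~ constant_on Omega f) :
  exists r : R, 0 < r /\ disk (f 0) r `<=` f @` Omega.
Proof.
have cf z : Omega z -> {for z, continuous f}.
  move=> /f_analytic[r [a [r0 _ fE]]].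
  by apply: power_series_continuous fE; rewrite ltcR.
have dich z : Omega z ->
    (\forall w \near z, f w = f z) \/ exists m c, leading_term f z m c.
  move=> /f_analytic[r [a [r0 _ fE]]].
  by apply: power_series_leading_term fE; rewrite ltcR.
have lead z : Omega z -> exists m c, leading_term f z m c.
  move=> Oz; have [fz|//] := dich z Oz; exfalso; apply: f_nonconstant.
  exists (f z); apply: identity_principle Oz fz => // w Ow.
  have [|[m [c wl]]] := dich w Ow; first by left.
  by right; exact: leading_term_isolated wl.
have O0 : Omega 0.
  by apply: disk_sub; rewrite /closed_disk /= subrr normr0 lecR ltW.
have [m [c /leading_term_isolated iso]] := lead _ O0.
have [s s0 [sO siso]] : exists2 s : R, 0 < s &
    closed_disk (0 : C R) s `<=` Omega /\
    forall z : C R, `|z| = (s%:C%C : C R) -> f z != f 0.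
  have [e /= e0 eiso] := (nbhs_normP _ _).1 iso.
  have eE : (complex.Re (e : R[i]))%:C%C = e.
    by apply: RRe_real; exact: gtr0_real.
  have e0' : 0 < complex.Re (e : R[i]) by rewrite -ltcR eE.
  (* Half of [e], because isolation is only known on the open disk. *)
  pose s := Num.min rho (complex.Re (e : R[i]) / 2).
  have s0 : 0 < s by rewrite lt_min rho_gt0 divr_gt0.
  have se : s < complex.Re (e : R[i]).
    by rewrite gt_min ltr_pdivrMr// ltr_pMr// ltr1n orbT.
  exists s => //; split=> [z zs|z zs].
    apply: disk_sub; apply: le_trans zs _; rewrite lecR.
    by rewrite ge_min lexx.
  apply: (eiso z); first by rewrite /= sub0r normrN zs -eE ltcR.
  have : 0 < `|z| by rewrite zs ltcR.
  by rewrite normr_gt0.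
pose S := [set z : C R | `|z| = (s%:C%C : C R)].
have SD : S `<=` closed_disk (0 : C R) s.
  by move=> z /= zs; rewrite /closed_disk /= subr0 zs.
have Scompact : compact S.
  apply: subclosed_compact SD; last exact: compact_closed_disk.
  rewrite (_ : S = (@modulus R) @^-1` [set s]).
    apply: preimage_closed; [move=> z _; exact: modulus_continuous|].
    exact: closed_eq.
  apply/seteqP; split=> z; rewrite /S /=.
    by move=> zs; apply: complexI; rewrite modulusE.
  by rewrite -modulusE => ->.
have [||z0 /siso fz0 z0min] :=
  compact_min_modulus S (fun z => f z - f 0) _ Scompact.
- by exists s%:C%C; rewrite /S/= ger0_norm// lecR ltW.
- move=> z /SD /sO Oz.
  by apply: continuousB; [exact: (cf z Oz)|exact: cst_continuous].
set d := modulus (f z0 - f 0).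
have dE : (d%:C)%C = `|f z0 - f 0| by exact: modulusE.
have d0 : 0 < d by rewrite -ltcR dE normr_gt0 subr_eq0.
exists (d / 2); split; first by rewrite divr_gt0.
move=> w; rewrite /disk -ball_normE /= => fw.
have [||z1 Dz1 z1min] := compact_min_modulus _ (fun z => f z - w) _
  (compact_closed_disk s).
- by exists 0; rewrite /closed_disk/= subrr normr0 lecR ltW.
- move=> z /sO Oz; apply: continuousB; [exact: (cf z Oz)|exact: cst_continuous].
exists z1; first exact: sO.
apply: contrapT => /eqP f1w.
(* On the circle [`|f z1 - w|] would exceed [d / 2 > `|f 0 - w|], so the
   minimum would be smaller at the centre. *)
have z1s : `|z1| < (s%:C%C : C R).
  rewrite lt_neqAle; move: (Dz1); rewrite /closed_disk /= subr0 => ->.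
  rewrite andbT; apply/eqP => z1s.
  have f1 := z0min z1 z1s.
  have := z1min 0; rewrite {1}/closed_disk /= subrr normr0 lecR (ltW s0).
  move=> /(_ isT) f10.
  have : `|f z0 - f 0| < `|f z0 - f 0|; last by rewrite ltxx.
  apply: le_lt_trans f1 _.
  rewrite (_ : f z1 - f 0 = (f z1 - w) - (f 0 - w)); last by ring.
  apply: le_lt_trans (ler_normB _ _) _.
  rewrite -dE (splitr d) rmorphD ltrD// (le_lt_trans f10)//.
(* The nearby point [z] with [`|f z - w| < `|f z1 - w|] contradicts the choice
   of [z1]. *)
have [m1 [c1 lead1]] := lead _ (sO _ Dz1).
have [|z Dz] :=
  leading_term_descent _ _ _ _ _ (closed_disk (0 : C R) s) lead1 f1w.
  apply/nbhs_normP; exists (s%:C%C - `|z1|); first by rewrite /= subr_gt0.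
  move=> z /=; rewrite ltrBrDr => zs; rewrite /closed_disk /= subr0.
  apply/ltW/le_lt_trans/zs; rewrite distrC -{1}(subrK z1 z).
  exact: ler_normD.
by rewrite lt_leAnge z1min ?andbF.
Qed.
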